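(* Let $r>0$ and let the real power series $\mathcal{A}(x)=\sum_{k=0}^\infty a_k x^k$ and $\mathcal{B}(x)=\sum_{k=0}^\infty b_k x^k$ converge on $(0,r)$, with $b_k>0$ for all $k\ge 0$. If there exists an integer $m \geq 1$ such that the sequence $\{a_k/b_k\}$ is strictly increasing (decreasing) for all $0\leq k\leq m$, then there exists $x_0 \in (0,r]$ such that the function $x\mapsto \mathcal{A}(x) / \mathcal{B}(x)$ is strictly increasing (decreasing) on $(0,x_0)$.
   Context: The statement comprises two versions: one with ''strictly increasing'' in both hypothesis and conclusion, the other with ''strictly decreasing'' in both. *)

(* Defs.v *)
From Stdlib Require Import Reals.
From Coquelicot Require Import Coquelicot.
Open Scope R_scope.

Definition seq_strictly_increasing_upto (u : nat -> R) (m : nat) : Prop :=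
  forall i j : nat, (i < j)%nat -> (j <= m)%nat -> u i < u j.

Definition seq_strictly_decreasing_upto (u : nat -> R) (m : nat) : Prop :=
  forall i j : nat, (i < j)%nat -> (j <= m)%nat -> u j < u i.

Definition fun_strictly_increasing_on (f : R -> R) (c d : R) : Prop :=
  forall x y : R, c < x < d -> c < y < d -> x < y -> f x < f y.

Definition fun_strictly_decreasing_on (f : R -> R) (c d : R) : Prop :=
  forall x y : R, c < x < d -> c < y < d -> x < y -> f y < f x.

(* Main.v *)
Require Import Defs.
From Stdlib Require Import Reals Lra.
From Coquelicot Require Import Coquelicot.
Open Scope R_scope.

(** Only the first two coefficients matter: the numerator [A' B - A B'] of the
    derivative of [A / B] is continuous at [0], where it equals
    [a 1 * b 0 - a 0 * b 1], so it keeps its sign near [0].  The decreasing case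
    is the increasing one for [- A]. *)

(** If the radius were below [Rabs y], the terms [a n * y ^ n] could not tend to 0, as those of a
    convergent series must. So the radius is at least [Rabs y], and the strict gap comes from
    [x]. *)
Lemma CV_radius_gt_of_ex_pseries (a : nat -> R) (x y : R) :
  ex_pseries a y -> Rabs x < Rabs y -> Rbar_lt (Rabs x) (CV_radius a).
Proof.
  intros Ha Hxy.
  apply Rbar_lt_le_trans with (Rabs y); [exact Hxy|].
  apply Rbar_not_lt_le; intros Hlt.
  apply (CV_disk_outside a y Hlt).
  apply is_lim_seq_ext with (fun n => scal (pow_n y n) (a n)).
  - intros n; rewrite pow_n_pow; apply Rmult_comm.
  - now apply ex_series_lim_0.
Qed.

Lemma CV_radius_pos_of_ex_pseries (a : nat -> R) (r : R) :
  0 < r -> (forall x, 0 < x < r -> ex_pseries a x) -> Rbar_lt 0 (CV_radius a).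
Proof.
  intros Hr Ha.
  rewrite <- Rabs_R0.
  apply CV_radius_gt_of_ex_pseries with (r / 2).
  - apply Ha; lra.
  - rewrite Rabs_R0, Rabs_pos_eq; lra.
Qed.

(** Preimage of an open condition under the continuous map [Rabs]; the radius may be infinite, hence
    openness in [Rbar]. *)
Lemma locally_lt_CV_radius (a : nat -> R) :
  Rbar_lt 0 (CV_radius a) ->
  locally 0 (fun x => Rbar_lt (Rabs x) (CV_radius a)).
Proof.
  intros Ha.
  apply (continuous_Rabs 0 (fun u => Rbar_lt u (CV_radius a))).
  rewrite Rabs_R0; exact (open_Rbar_lt' 0 _ Ha).
Qed.

Lemma continuous_PSeries_0 (a : nat -> R) :
  Rbar_lt 0 (CV_radius a) -> continuous (PSeries a) 0.
Proof.
  intros Ha; apply continuity_pt_filterlim, PSeries_continuity.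
  now rewrite Rabs_R0.
Qed.

(** Stated with radii and the sign of the determinant, so that it applies to [a] and to [PS_opp a]
    alike; [r] only caps [x0]. *)
Lemma PSeries_div_increasing_near_0 (r : R) (a b : nat -> R) :
  0 < r ->
  Rbar_lt 0 (CV_radius a) -> Rbar_lt 0 (CV_radius b) ->
  0 < b O -> 0 < a 1%nat * b O - a O * b 1%nat ->
  exists x0 : R, 0 < x0 <= r /\
    fun_strictly_increasing_on (fun x => PSeries a x / PSeries b x) 0 x0.
Proof.
  intros Hr Ha Hb Hb0 Hab.
  (* The quotient has derivative [W / B ^ 2]. *)
  set (W x := PSeries (PS_derive a) x * PSeries b x
              - PSeries a x * PSeries (PS_derive b) x).
  assert (HW : continuous W 0).
  { apply (continuous_minus (U := R_UniformSpace) (V := R_NormedModule));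
      apply (continuous_mult (U := R_UniformSpace) (K := R_AbsRing));
      apply continuous_PSeries_0; rewrite ?CV_radius_derive; assumption. }
  assert (HW0 : 0 < W 0).
  { unfold W; rewrite !PSeries_0; unfold PS_derive; simpl; lra. }
  assert (HB0 : 0 < PSeries b 0) by now rewrite PSeries_0.
  assert (LW : locally 0 (fun x => 0 < W x)) by exact (HW _ (open_gt 0 _ HW0)).
  assert (LB : locally 0 (fun x => 0 < PSeries b x))
    by exact (continuous_PSeries_0 b Hb _ (open_gt 0 _ HB0)).
  (* One radius [d] serves all four conditions: both signs, and membership in both discs of
     convergence. *)
  destruct (filter_and _ _ (filter_and _ _ LW LB)
             (filter_and _ _ (locally_lt_CV_radius a Ha)
                             (locally_lt_CV_radius b Hb))) as [d Hd].
  exists (Rmin d r).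
  pose proof (cond_pos d); pose proof (Rmin_l d r); pose proof (Rmin_r d r).
  split; [split; [now apply Rmin_pos|assumption]|].
  assert (Hnear : forall z, 0 < z < Rmin d r ->
    (0 < W z /\ 0 < PSeries b z) /\
    (Rbar_lt (Rabs z) (CV_radius a) /\ Rbar_lt (Rabs z) (CV_radius b))).
  { intros z Hz; apply Hd.
    change (Rabs (z - 0) < d); rewrite Rminus_0_r, Rabs_pos_eq; lra. }
  intros x y Hx Hy Hxy.
  apply (incr_function (fun z => PSeries a z / PSeries b z) 0 (Rmin d r)
           (fun z => W z / PSeries b z ^ 2));
    simpl; try lra.
  - intros z Hz1 Hz2.
    destruct (Hnear z (conj Hz1 Hz2)) as [[_ HBz] [Haz Hbz]].
    apply is_derive_div; try apply is_derive_PSeries; trivial; lra.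
  - intros z Hz1 Hz2.
    destruct (Hnear z (conj Hz1 Hz2)) as [[HWz HBz] _].
    apply Rdiv_lt_0_compat; [assumption|].
    now apply (pow_lt _ 2).
Qed.

Theorem mainTheorem5 (r : R) (a b : nat -> R)
  (hr : 0 < r)
  (ha : forall x : R, 0 < x < r -> ex_pseries a x)
  (hb : forall x : R, 0 < x < r -> ex_pseries b x)
  (hbpos : forall k : nat, 0 < b k) :
  ((exists m : nat, (1 <= m)%nat /\
      seq_strictly_increasing_upto (fun k => a k / b k) m) ->
   exists x0 : R, 0 < x0 <= r /\
      fun_strictly_increasing_on (fun x => PSeries a x / PSeries b x) 0 x0)
  /\
  ((exists m : nat, (1 <= m)%nat /\
      seq_strictly_decreasing_upto (fun k => a k / b k) m) ->
   exists x0 : R, 0 < x0 <= r /\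
      fun_strictly_decreasing_on (fun x => PSeries a x / PSeries b x) 0 x0).
Proof.
  pose proof (CV_radius_pos_of_ex_pseries a r hr ha) as Ha.
  pose proof (CV_radius_pos_of_ex_pseries b r hr hb) as Hb.
  pose proof (hbpos 0%nat) as Hb0; pose proof (hbpos 1%nat) as Hb1.
  (* The determinant has the sign of the first increment of [a k / b k], since [b 0 * b 1] is
     positive. *)
  assert (Hdet : a 1%nat * b 0%nat - a 0%nat * b 1%nat =
    (a 1%nat / b 1%nat - a 0%nat / b 0%nat) * (b 0%nat * b 1%nat))
    by (field; lra).
  pose proof (Rmult_lt_0_compat _ _ Hb0 Hb1) as Hbb.
  split; intros [m [Hm Hmono]]; specialize (Hmono 0%nat 1%nat Nat.lt_0_1 Hm);
    cbv beta in Hmono.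
  - apply PSeries_div_increasing_near_0; trivial.
    rewrite Hdet; apply Rmult_lt_0_compat; lra.
  - destruct (PSeries_div_increasing_near_0 r (PS_opp a) b) as [x0 [Hx0 Hinc]];
      trivial.
    + now rewrite CV_radius_opp.
    + change (0 < - a 1%nat * b 0%nat - - a 0%nat * b 1%nat).
      replace (- a 1%nat * b 0%nat - - a 0%nat * b 1%nat)
        with ((a 0%nat / b 0%nat - a 1%nat / b 1%nat) * (b 0%nat * b 1%nat))
        by (field; lra).
      apply Rmult_lt_0_compat; lra.
    + exists x0; split; [assumption|].
      intros x y Hx Hy Hxy.
      specialize (Hinc x y Hx Hy Hxy); cbv beta in Hinc.
      rewrite !PSeries_opp in Hinc.
      (* With division written as a product, the sign of [- A] factors out and negating reverses the
         inequality. *)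
      unfold Rdiv in *; lra.
Qed.
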